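(* Let $X$ be an infinite-dimensional complex Banach space and let $T$ be a generalized Drazin invertible bounded linear operator on $X$ with generalized Drazin inverse $T^D$. If $T$ has the SVEP, then for every $x\in X$, $$\sigma_{T^D}(x)\setminus\{0\}=\left\{\frac1\lambda:\lambda\in\sigma_T(x)\setminus\{0\}\right\}.$$
   Context: A bounded operator $T$ on $X$ is generalized Drazin invertible if there is a bounded operator $S$ on $X$ with $ST=TS$, $STS=S$ and $TST=T+U$ with $U$ quasinilpotent (equivalently, $0$ is not an accumulation point of $\sigma(T)$). Such $S$ is unique; it is called the generalized Drazin inverse of $T$ and denoted $T^D$. $T$ has the single-valued extension property (SVEP) at $\lambda_0\in\mathbb{C}$ if for every open neighborhood $\mathcal{U}$ of $\lambda_0$ the only analytic function $f:\mathcal{U}\to X$ satisfying $(\lambda I-T)f(\lambda)=0$ on $\mathcal{U}$ is $f\equiv0$; $T$ has the SVEP if it has the SVEP at every $\lambda_0\in\mathbb{C}$. The local resolvent set $\rho_T(x)$ of $T$ at $x\in X$ is the union of all open sets $U\subseteq\mathbb{C}$ for which there is an analytic function $f:U\to X$ with $(\lambda I-T)f(\lambda)=x$ for all $\lambda\in U$. The local spectrum of $T$ at $x$ is $\sigma_T(x)=\mathbb{C}\setminus\rho_T(x)$. *)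

(* Defs.v *)
From mathcomp Require Import all_boot all_order all_algebra.
From mathcomp Require Import all_classical all_reals all_analysis.
From mathcomp Require Export complex.

Set Implicit Arguments.
Unset Strict Implicit.
Unset Printing Implicit Defensive.

Import Order.TTheory GRing.Theory Num.Theory.
Import numFieldNormedType.Exports.

Local Open Scope classical_set_scope.
Local Open Scope ring_scope.

(* The definitions are stated over any numeric field K; they are meant to be
   used with K := R[i]. *)

Definition bounded_operator (K : numFieldType) (X : normedModType K)
    (T : {linear X -> X}) : Prop :=
  bounded_near T (nbhs (0 : X)).

Definition finite_dimensional (K : numFieldType) (X : lmodType K) : Prop :=
  exists (n : nat) (b : 'I_n -> X),
    forall x : X, exists c : 'I_n -> K, x = \sum_(i < n) c i *: b i.

Definition resolvent_set (K : numFieldType) (X : normedModType K)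
    (T : {linear X -> X}) : set K :=
  [set l | exists S : {linear X -> X}, [/\ bounded_operator S,
     (forall x, S (l *: x - T x) = x) & (forall x, l *: S x - T (S x) = x)]].

Definition spectrum (K : numFieldType) (X : normedModType K)
    (T : {linear X -> X}) : set K :=
  ~` resolvent_set T.

Definition quasinilpotent (K : numFieldType) (X : normedModType K)
    (T : {linear X -> X}) : Prop :=
  spectrum T = [set 0].

Definition generalized_Drazin_inverse (K : numFieldType) (X : normedModType K)
    (T S : {linear X -> X}) : Prop :=
  [/\ bounded_operator S,
      S \o T =1 T \o S,
      S \o T \o S =1 S
    & exists U : {linear X -> X}, [/\ bounded_operator U, quasinilpotent U
        & forall x, T (S (T x)) = T x + U x]].

(* For K := R[i], derivable f l 1 is complex differentiability of f at l, so
   that analytic means holomorphic. The values of f outside A, an open set in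
   all the uses below, are irrelevant. *)
Definition analytic_on (K : numFieldType) (X : normedModType K)
    (A : set K) (f : K -> X) : Prop :=
  forall l, A l -> derivable f l 1.

Definition SVEP_at (K : numFieldType) (X : normedModType K)
    (T : {linear X -> X}) (l0 : K) : Prop :=
  forall A : set K, open A -> A l0 ->
  forall f : K -> X, analytic_on A f ->
    (forall l, A l -> l *: f l - T (f l) = 0) ->
    forall l, A l -> f l = 0.

Definition SVEP (K : numFieldType) (X : normedModType K)
    (T : {linear X -> X}) : Prop :=
  forall l0 : K, SVEP_at T l0.

Definition local_resolvent_set (K : numFieldType) (X : normedModType K)
    (T : {linear X -> X}) (x : X) : set K :=
  \bigcup_(A in [set A : set K | open A /\
      exists f : K -> X, analytic_on A f /\
        forall l, A l -> l *: f l - T (f l) = x]) A.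

Definition local_spectrum (K : numFieldType) (X : normedModType K)
    (T : {linear X -> X}) (x : X) : set K :=
  ~` local_resolvent_set T x.

(* Main.v *)
Require Import Defs.
From mathcomp Require Import all_boot all_order all_algebra.
From mathcomp Require Import all_classical all_reals all_analysis.

Import Order.TTheory GRing.Theory Num.Theory.
Import numFieldNormedType.Exports.

Local Open Scope classical_set_scope.
Local Open Scope ring_scope.

(** The operator [P = T S] is a projection commuting with [T] and its
    generalized Drazin inverse [S], and every [x] splits as
    [x = P x + (x - P x)].  Fix [l != 0]; analytic solutions of
    [(l - T) f(l) = x] near [l] are turned into analytic solutions of
    [(l^-1 - S) g = x] near [l^-1], and conversely, one summand at a time.

    - On the range of [P] the operators [T P] and [S] are inverse to each
      other, so [l - T P = - l T P (l^-1 - S)].  Solutions are therefore carried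
      along [l |-> l^-1]: this is [local_resolvent_set_inv].
    - On the range of [1 - P] neither operator has local spectrum away from
      [0]: there [S] vanishes, while [T] is the quasinilpotent operator [- U],
      whose resolvent is analytic on the punctured plane
      ([resolvent_set_local_resolvent_set], [quasinilpotent_resolvent_setN]).

    The pieces are moved between the ranges and the whole space by operators
    intertwining the equations ([local_resolvent_set_intertwine]).  Hence
    [l^-1] is in the local resolvent set of [S] at [x] exactly when [l] is in
    that of [T] ([local_resolvent_set_Drazin]), and the theorem is the
    complementary statement about local spectra. *)

Section LocalResolvent.
Context (K : numFieldType) (X : normedModType K).
Implicit Types (A B C N T S U : {linear X -> X}) (x y : X) (l m : K).

Lemma bounded_operator_lin_differentiable A x :
  bounded_operator A -> differentiable A x.
Proof. by move=> /linear_bounded_continuous/linear_differentiable. Qed.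

Lemma bounded_operator_comp A B :
  bounded_operator A -> bounded_operator B ->
  bounded_operator (A \o B : {linear X -> X}).
Proof.
move=> /linear_bounded_continuous cA /linear_bounded_continuous cB.
apply/linear_bounded_continuous => y.
by apply: continuous_comp; [exact: cB|exact: cA].
Qed.

Lemma open_neq0 : open [set m : K | m != 0].
Proof.
have -> : [set m : K | m != 0] = ~` [set 0] by apply/seteqP; split=> m /eqP.
rewrite openC; apply: accessible_closed_set1.
exact/hausdorff_accessible/norm_hausdorff.
Qed.

Lemma local_resolvent_set0 x l : l != 0 -> local_resolvent_set \0 x l.
Proof.
move=> l0; exists [set m | m != 0] => //; split.
  exact: open_neq0.
exists (fun m => m^-1 *: x); split => m /= m0.
  apply/derivable1_diffP/differentiableZl/differentiableV => //.
by rewrite subr0 scalerA divff // scale1r.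
Qed.

Lemma local_resolvent_setD A x y l :
  local_resolvent_set A x l -> local_resolvent_set A y l ->
  local_resolvent_set A (x + y) l.
Proof.
move=> [D [oD [f [df Af]]] Dl] [E [oE [g [dg Ag]]] El].
exists (D `&` E) => //; split; first exact: openI.
exists (f + g); split=> m [Dm Em]; first by apply: derivableD; auto.
by rewrite [(f + g) m]/(f m + g m) scalerDr linearD opprD addrACA Af // Ag.
Qed.

(** Applying [C] to a solution of [(l - A) f(l) = x] gives a solution of
    [(l - B) (C f(l)) = C x].  With [C] a projection this cuts a local problem
    down to an invariant range, or brings it back to the whole space. *)
Lemma local_resolvent_set_intertwine A B C x l :
  bounded_operator C -> C \o A =1 B \o C ->
  local_resolvent_set A x l -> local_resolvent_set B (C x) l.
Proof.
move=> bC CA [D [oD [f [df Af]]] Dl].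
exists D => //; split=> //; exists (C \o f); split=> m Dm.
  apply/derivable1_diffP/differentiable_comp; first exact/derivable1_diffP/df.
  exact: bounded_operator_lin_differentiable.
by have /= <- := CA (f m); rewrite -linearZ -linearB Af.
Qed.

(** From [(l - A) u = x] and [A B A = A] one computes
    [(l^-1 - B) (- l A u) = B A x].  Analyticity is seen without
    differentiating a product of a scalar and a vector function, because
    [l A u = A (l u) = A (A u + x)] is a continuous affine function of [u]. *)
Lemma local_resolvent_set_inv A B x l :
  bounded_operator A -> A \o B =1 B \o A -> A \o B \o A =1 A -> l != 0 ->
  local_resolvent_set A x l -> local_resolvent_set B (B (A x)) l^-1.
Proof.
move=> bA AB ABA l0 [D [oD [f [df Af]]] Dl].
have Ef m : D m -> A (f m) = m *: f m - x.
  by move=> Dm; rewrite -(Af m Dm) opprB addrC subrK.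
exists [set m | m != 0 /\ D m^-1]; last by split; [exact: invr_neq0|rewrite /= invrK].
split.
  rewrite openE => m [m0 Dm]; apply: filterI.
    by apply: open_nbhs_nbhs; split => //; exact: open_neq0.
  by apply: (inv_continuous m0); apply: open_nbhs_nbhs.
exists (fun m => - A (A (f m^-1) + x)); split=> m [m0 Dm].
  apply/derivable1_diffP.
  have dfi : differentiable (f \o (@GRing.inv K)) m.
    apply: differentiable_comp; first exact: differentiableV.
    exact/derivable1_diffP/df.
  have dA y : differentiable A y by exact: bounded_operator_lin_differentiable.
  apply: differentiableN.
  apply: (@differentiable_comp _ _ _ _ (fun m => A (f m^-1) + x) A) => //.
  apply: differentiableD => //.
  exact: (differentiable_comp dfi).
have AB' y : B (A y) = A (B y) by rewrite -[LHS]AB.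
have ABA' y : A (B (A y)) = A y by rewrite -[RHS]ABA.
have E : m *: (A (f m^-1) + x) = f m^-1.
  by rewrite Ef // subrK scalerA divff // scale1r.
rewrite [B (- _)]linearN opprK scalerN -[m *: A _]linearZ E.
by rewrite [A (_ + x)]linearD [B (_ + _)]linearD AB' ABA' addKr.
Qed.

(** The solution is the resolvent orbit [m |-> (m - N)^-1 x].  By the resolvent
    identity its difference quotient at [m] is [- S m (S p x)], so everything
    reduces to the continuity of the orbit; that in turn follows from the same
    identity, because it bounds [S p x] for [p] near [m]. *)
Lemma resolvent_set_local_resolvent_set N (D : set K) x l :
  open D -> D `<=` resolvent_set N -> D l -> local_resolvent_set N x l.
Proof.
move=> oD DN Dl; exists D => //; split=> //.
pose P m (S : {linear X -> X}) := [/\ bounded_operator S,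
     (forall x, S (m *: x - N x) = x) & (forall x, m *: S x - N (S x) = x)].
have [S SP] : exists S : K -> {linear X -> X}, forall m, D m -> P m (S m).
  have : forall m, exists S : {linear X -> X}, D m -> P m S.
    move=> m; have [Dm|nDm] := pselect (D m); last by exists \0.
    by have [S ?] := DN m Dm; exists S.
  by move=> /choice[S ?]; exists S.
exists (fun m => S m x); split; last by move=> m /SP [].
move=> m {Dl}Dm.
have [bS SN _] := SP m Dm.
have cS : continuous (S m) by apply/linear_bounded_continuous.
have resE p : D p -> S p x - S m x = - ((p - m) *: S m (S p x)).
  move=> /SP[_ _ NS].
  have E : m *: S p x - N (S p x) = x - (p - m) *: S p x.
    by rewrite -{3}(NS x) scalerBl opprB [RHS]addrC addrA subrK.
  by rewrite -{1}(SN (S p x)) E linearB linearZ /= addrC addKr.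
have nearD : \forall p \near m, D p by apply: open_nbhs_nbhs.
have [k k0 Sk] := linear_lipschitz cS.
have Scvg : S p x @[p --> m] --> S m x.
  apply/(@cvgrPdist_lt _ _ _ (nbhs m)) => e e0.
  near=> p.
  have pD : D p by near: p.
  (* 1/2 lets the resolvent identity absorb `|S p x| into the left-hand side. *)
  have pk : `|m - p| * k <= 2^-1.
    rewrite -ler_pdivlMr //; near: p; apply: cvgr_dist_le => //.
    by rewrite divr_gt0.
  have le1 : `|S m x - S p x| <= `|m - p| * k * `|S p x|.
    rewrite distrC resE // normrN normrZ distrC -mulrA ler_wpM2l //.
  have le2 : `|S p x| <= 2 * `|S m x|.
    have : `|S p x| <= `|S m x| + 2^-1 * `|S p x|.
      rewrite -lerBlDl (le_trans (lerB_dist _ _)) // distrC (le_trans le1) //.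
      exact: ler_wpM2r.
    rewrite -lerBlDr {1}[`|S p x|]splitr [2^-1 * _]mulrC addrK.
    by rewrite ler_pdivrMr // mulrC.
  apply: le_lt_trans le1 _.
  apply: le_lt_trans (_ : `|m - p| * (k * (2 * `|S m x|)) < e).
    by rewrite -mulrA ler_wpM2l // ler_wpM2l // ltW.
  (* The + 1 keeps the constant positive, so that one can divide by it. *)
  apply: le_lt_trans (_ : `|m - p| * (k * (2 * `|S m x|) + 1) < e).
    by rewrite ler_wpM2l // lerDl.
  rewrite -ltr_pdivlMr //; last first.
    by rewrite ltr_wpDl // !mulr_ge0 // ltW.
  near: p; apply: cvgr_dist_lt => //.
  by rewrite divr_gt0 // ltr_wpDl // !mulr_ge0 // ltW.
have shiftcvg : h *: 1 + m @[h --> (0 : K)^'] --> m.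
  have : h *: 1 + m @[h --> (0 : K)^'] --> (0 *: 1 + m : K).
    apply: cvg_within_filter.
    by apply: cvgD; [apply: cvgZr_tmp|apply: cvg_cst].
  by rewrite scale0r add0r.
apply/cvg_ex; exists (- S m (S m x)).
have : - S m (S (h *: 1 + m) x) @[h --> (0 : K)^'] --> - S m (S m x).
  apply: cvgN; apply: continuous_cvg; first exact: cS.
  exact: (cvg_comp _ _ shiftcvg Scvg).
apply: cvg_trans; apply: near_eq_cvg; near=> h.
rewrite /= resE; last by near: h; exact: shiftcvg.
rewrite addrK [_ *: 1]mulr1 scalerN scalerA mulVf ?scale1r //.
by near: h; exact: nbhs_dnbhs_neq.
Unshelve. all: by end_near.
Qed.

Lemma quasinilpotent_resolvent_setN U : quasinilpotent U ->
  [set l | l != 0] `<=` resolvent_set (\- U : {linear X -> X}).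
Proof.
move=> qU l /= l0.
have [R [bR RU UR]] : resolvent_set U (- l).
  apply: contrapT => nl.
  have : spectrum U (- l) by [].
  by rewrite qU /= => /eqP; rewrite oppr_eq0 (negbTE l0).
exists (\- R : {linear X -> X}); split=> [|y|y] /=.
- apply/linear_bounded_continuous => y; apply: cvgN.
  exact: (linear_bounded_continuous R).1.
- by rewrite -linearN opprB addrC -scaleNr RU.
- by rewrite [U (- R y)]linearN opprK scalerN -scaleNr UR.
Qed.

(** The summand [T S x] is handled by inversion.  From [S] to [T] this is
    [local_resolvent_set_inv] itself, because [S T S = S].  From [T] to [S] it
    must be applied to [T S T] in place of [T], because [T S T = T] fails unless
    [U = 0].  The other summand is the image of [x] under [Q = 1 - T S], which
    intertwines [- U] with [T] and [0] with [S]. *)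
Lemma local_resolvent_set_Drazin T S x l :
  bounded_operator T -> generalized_Drazin_inverse T S -> l != 0 ->
  local_resolvent_set S x l^-1 <-> local_resolvent_set T x l.
Proof.
move=> bT [bS ST STS [U [_ qU TST]]] l0.
pose Q : {linear X -> X} := idfun \- (T \o S).
have QE y : Q y = y - T (S y) by [].
have Qx : x = T (S x) + Q x by rewrite QE addrC subrK.
have STE y : S (T y) = T (S y) by exact: ST.
have STSE y : T (S (S y)) = S y by rewrite -STE -[RHS]STS.
have bQ : bounded_operator Q.
  have /linear_bounded_continuous cTS := bounded_operator_comp _ _ bT bS.
  apply/linear_bounded_continuous => y.
  by apply: (@cvgB _ _ _ (nbhs y)) => //; exact: cTS.
split=> [Sxl|Txl]; rewrite Qx; apply: local_resolvent_setD.
- rewrite -[l]invrK; apply: local_resolvent_set_inv => //.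
  exact: invr_neq0.
- apply: (@local_resolvent_set_intertwine (\- U : {linear X -> X})) => //.
    move=> y; change (Q (- U y) = T (Q y)); rewrite !QE.
    have -> : U y = T (S (T y)) - T y by rewrite TST addrC addKr.
    by rewrite !opprB !linearB /= !STE STSE subrr addr0.
  apply: (resolvent_set_local_resolvent_set _ [set m | m != 0]) => //.
    exact: open_neq0.
  exact: quasinilpotent_resolvent_setN.
- have -> : T (S x) = S ((T \o S \o T) ((S \o T) x)).
    by rewrite /= !STE !STSE.
  apply: local_resolvent_set_inv => //.
  + exact/bounded_operator_comp/bT/bounded_operator_comp.
  + by move=> y /=; rewrite !STE.
  + by move=> y /=; rewrite !STE !STSE.
  apply: (@local_resolvent_set_intertwine T) => //.
    exact: bounded_operator_comp.
  by move=> y /=; rewrite !STE STSE.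
- apply: (@local_resolvent_set_intertwine \0) => //.
    move=> y; change (Q 0 = S (Q y)); rewrite !QE linearB linear0 /=.
    by rewrite STE STSE subrr linear0 subr0.
  by apply: local_resolvent_set0; rewrite invr_neq0.
Qed.
End LocalResolvent.

Theorem theorem4p5 (R : realType) (X : completeNormedModType R[i])
    (X_infinite_dimensional : ~ finite_dimensional X)
    (T TD : {linear X -> X}) (T_bounded : bounded_operator T)
    (TD_inverse : generalized_Drazin_inverse T TD)
    (T_SVEP : SVEP T) (x : X) :
  local_spectrum TD x `\ 0 =
  [set l^-1 | l in local_spectrum T x `\ 0].
Proof.
apply/seteqP; split=> l.
- move=> [lS /eqP l0]; exists l^-1; last by rewrite invrK.
  split; last exact/eqP/invr_neq0.
  move=> /(local_resolvent_set_Drazin _ _ _ _ _ _ T_bounded TD_inverse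
    (invr_neq0 l0)).2.
  by rewrite invrK.
- move=> [m [mT /eqP m0] <-]; split; last exact/eqP/invr_neq0.
  by move=> /(local_resolvent_set_Drazin _ _ _ _ _ _ T_bounded TD_inverse m0).1.
Qed.
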